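(* Consider the system $p_1(S,m,x,y)=p_2(S,m,x,y)=p_3(S,m,x,y)=0$. Every integral solution $(S_0,m_0,x_0,y_0)$ with $S_0\neq0$, $m_0\neq 0$, $x_0\geq 1$ for which the quantities $\Lambda,T,n,k,r,s,\lambda,N,P$ defined below are all integers at $(S_0,m_0,x_0,y_0)$ lies on one of the following parametrized curves (parameter $z$): (i) $S=\tfrac12 z(3z+1)$, $m=\tfrac92 z(z+1)$, $x=\tfrac12 z(z+1)$, $y=\tfrac12 z(z-1)$; (ii) $S=m=x=y=z$; (iii) $S=z+1$, $m=z$, $x=z$, $y=z+1$.
   Context: $p_1= S^4 - 2S^2xm + x^2m^2 - 2S^3 + 2S^2x - 2Sxm + 2x^2m + S^2 - 2Sx + x^2$; $p_2= S^4 + 2S^2xm - 4S^2ym + x^2m^2 - 4xym^2 + 4y^2m^2 - 2S^3 + 2S^2x + 8S^2m - 6Sxm - 2x^2m- 4Sym + 4xym - 4Sm^2 + 4xm^2 + S^2 - 2Sx + x^2$; $p_3=S^2x^2 - Smx^2 - 2S^2xy + 2Smxy + S^2y^2 - Smy^2 + S^2m + 2S^2x - 2Smx - 2Sx^2 + mx^2 - 2S^2y + 2Sxy + S^2 - 2Sx + x^2$. $\Lambda=\frac{S(S-1)(S-x)(S-y)}{S^4-2S^3-((x+y-1)(m-1)-1)S^2+xym(m-1)}$, $T=\frac{(m-1)\Lambda}{S-1}$, $N=\frac{x(m-S)(S(S-1)-y(m-1))\Lambda}{S(x-y)(S-x)(S-1)}$, $P=\frac{(S(S-1)-y(m-1))\Lambda}{(x-y)(S-1)}$,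 $r=\frac{1}{x-y}\left(\frac{(m-S)\Lambda}{S-1}-(S-y)\right)$, $k=\frac{(m-S)(S(S-1)-y(m-1))\Lambda}{(x-y)(S-x)(S-1)}$, $n=\frac{mT}{S}$, $s=\frac{y-S}{x-y}$, $\lambda=k+r+s+rs$ (parameters of a quasi-symmetric design with intersection numbers $x,y$ and of its block graph). *)

(* Defs.v *)
From mathcomp Require Import all_boot all_order all_algebra.

Set Implicit Arguments.
Unset Strict Implicit.
Unset Printing Implicit Defensive.

Import Order.TTheory GRing.Theory Num.Theory.
Local Open Scope ring_scope.

Definition p1 (S m x y : int) : int :=
  S ^+ 4 - 2 * S ^+ 2 * x * m + x ^+ 2 * m ^+ 2 - 2 * S ^+ 3
  + 2 * S ^+ 2 * x - 2 * S * x * m + 2 * x ^+ 2 * m + S ^+ 2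
  - 2 * S * x + x ^+ 2.

Definition p2 (S m x y : int) : int :=
  S ^+ 4 + 2 * S ^+ 2 * x * m - 4 * S ^+ 2 * y * m + x ^+ 2 * m ^+ 2
  - 4 * x * y * m ^+ 2 + 4 * y ^+ 2 * m ^+ 2 - 2 * S ^+ 3 + 2 * S ^+ 2 * x
  + 8 * S ^+ 2 * m - 6 * S * x * m - 2 * x ^+ 2 * m - 4 * S * y * m
  + 4 * x * y * m - 4 * S * m ^+ 2 + 4 * x * m ^+ 2 + S ^+ 2
  - 2 * S * x + x ^+ 2.

Definition p3 (S m x y : int) : int :=
  S ^+ 2 * x ^+ 2 - S * m * x ^+ 2 - 2 * S ^+ 2 * x * y + 2 * S * m * x * y
  + S ^+ 2 * y ^+ 2 - S * m * y ^+ 2 + S ^+ 2 * m + 2 * S ^+ 2 * x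
  - 2 * S * m * x - 2 * S * x ^+ 2 + m * x ^+ 2 - 2 * S ^+ 2 * y
  + 2 * S * x * y + S ^+ 2 - 2 * S * x + x ^+ 2.

(* Division on [rat] is total, with a / 0 = 0. No denominator below is assumed
   to be nonzero, so integrality (see [integral_at]) is never a stronger
   condition than "defined and integral". *)

Definition par_Lambda (S m x y : rat) : rat :=
  (S * (S - 1) * (S - x) * (S - y))
  / (S ^+ 4 - 2 * S ^+ 3 - ((x + y - 1) * (m - 1) - 1) * S ^+ 2
     + x * y * m * (m - 1)).

Definition par_T (S m x y : rat) : rat :=
  ((m - 1) * par_Lambda S m x y) / (S - 1).

Definition par_N (S m x y : rat) : rat :=
  (x * (m - S) * (S * (S - 1) - y * (m - 1)) * par_Lambda S m x y)
  / (S * (x - y) * (S - x) * (S - 1)).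

Definition par_P (S m x y : rat) : rat :=
  ((S * (S - 1) - y * (m - 1)) * par_Lambda S m x y)
  / ((x - y) * (S - 1)).

Definition par_r (S m x y : rat) : rat :=
  1 / (x - y) * (((m - S) * par_Lambda S m x y) / (S - 1) - (S - y)).

Definition par_k (S m x y : rat) : rat :=
  ((m - S) * (S * (S - 1) - y * (m - 1)) * par_Lambda S m x y)
  / ((x - y) * (S - x) * (S - 1)).

Definition par_n (S m x y : rat) : rat :=
  (m * par_T S m x y) / S.

Definition par_s (S m x y : rat) : rat :=
  (y - S) / (x - y).

Definition par_lambda (S m x y : rat) : rat :=
  par_k S m x y + par_r S m x y + par_s S m x y
  + par_r S m x y * par_s S m x y.

Definition integral_at (f : rat -> rat -> rat -> rat -> rat)
    (S m x y : int) : Prop :=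
  f S%:Q m%:Q x%:Q y%:Q \is a Num.int.

(* Main.v *)
(** With [u = S - x] and [d = x - y] the system forces [d = 0] (curve (ii)) or
    [u = d^2] and [m x = (S + d)^2].  In the latter case put [e = d (d + 1)];
    then [c = e^2 / x = m - x - 2 e] is an integer and [Lambda], [T], [n], [P]
    and [r + d + 1] are fractions with the common denominator
    [E = 2 x^2 + 3 e x + 2 x + e - e c].  Two explicit integral combinations of
    them equal [2 x e / E] and [2 e^2 / E] up to integers, so [E] divides
    [2 e gcd(x, e)].  As [x E = (x + e) (x + e + 1) (2 x - e) + e^2] and
    [gcd(x, e)] divides [2 x - e], comparing sizes leaves only [2 x = e]
    (curve (i)) and [e = 0] (curve (iii)). *)

Require Import Defs.
From mathcomp Require Import all_boot all_order all_algebra.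
From mathcomp Require Import ring lra zify.

Import Order.TTheory GRing.Theory Num.Theory.
Local Open Scope ring_scope.

(** * Integral solutions of the polynomial system *)

(** With [c] and [j] nonnegative, either [j >= c + 2], which forces [4 * c <= 0], or [j = c + 1],
    which fails by parity. *)
Lemma sqrz_add4 (c j : int) : j ^+ 2 = c ^+ 2 + 4 -> c = 0.
Proof.
wlog hj : j / 0 <= j => [hw hjc|].
  by apply: (hw `|j|); rewrite ?real_normK ?num_real.
wlog hc : c / 0 <= c => [hw hjc|].
  apply/eqP; rewrite -normr_eq0; apply/eqP/hw => //.
  by rewrite real_normK ?num_real.
move=> hjc; case: (leP j (c + 1)) => hjc1; last by nia.
case: (leP j c) => hjc2; first by nia.
have ? : j = c + 1 by lia.
by subst j; lia.
Qed.

Lemma mulzS_gt0 (d : int) : d != 0 -> d != -1 -> 0 < d * (d + 1).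
Proof. by move=> d0 d1; nia. Qed.

Lemma dvdz_sqr (a b : int) : (a ^+ 2 %| b ^+ 2)%Z = (a %| b)%Z.
Proof. by rewrite !dvdzE !abszX dvdn_pexp2r. Qed.

(** Eliminating [u] leaves a quadratic equation in [S] with discriminant
    [m ^+ 2 * ((m + 1) ^+ 2 + 4)]. An integral root makes [(m + 1) ^+ 2 + 4] a square, so [m = -1],
    and the linear relation then reads [m * d = 0]. *)
Lemma excluded_factor (S m u d : int) :
  m != 0 -> d != 0 -> (m + 1) * u + m * d = 0 ->
  (m + 1) * u ^+ 2 + 2 * S * u * d + S * (S - m) * d ^+ 2 = 0 -> False.
Proof.
move=> m0 d0 hu hq.
have hS : (m + 1) * S * (S - m) = m * (2 * S - m).
  apply/eqP; rewrite -subr_eq0; apply/eqP; apply: (mulfI d0); apply: (mulfI d0).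
  rewrite !mulr0; transitivity ((m + 1) *
    ((m + 1) * u ^+ 2 + 2 * S * u * d + S * (S - m) * d ^+ 2)
    - ((m + 1) * u + m * d) * ((m + 1) * u - m * d + 2 * S * d)); first by ring.
  by rewrite hq hu mulr0 mul0r subrr.
have hK : (2 * (m + 1) * S - m * (m + 3)) ^+ 2 = m ^+ 2 * ((m + 1) ^+ 2 + 4).
  apply/eqP; rewrite -subr_eq0; apply/eqP.
  transitivity (4 * (m + 1) * ((m + 1) * S * (S - m) - m * (2 * S - m))).
    by ring.
  by rewrite hS subrr mulr0.
have /dvdzP[j hj] : (m %| 2 * (m + 1) * S - m * (m + 3))%Z.
  by rewrite -dvdz_sqr hK dvdz_mulr.
have m1 : m + 1 = 0.
  apply: (@sqrz_add4 _ j); apply: (mulfI (expf_neq0 2 m0)).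
  by rewrite -hK hj; ring.
move: hu; rewrite m1 mul0r add0r => /eqP.
by rewrite mulf_eq0 (negPf m0) (negPf d0).
Qed.

(* Eliminating [S (S - m)] from [p2 - p1] and [p3] gives
   [(d^2 - u) ((m + 1) u + m d) = 0] for [u = S - x] and [d = x - y]. *)
Lemma system_solutions (S m x y : int) :
  p1 S m x y = 0 -> p2 S m x y = 0 -> p3 S m x y = 0 -> m != 0 -> S != 0 ->
  [/\ S = x, y = x & m = x] \/
  [/\ x != y, S = x + (x - y) ^+ 2 & m * x = (S + (x - y)) ^+ 2].
Proof.
move=> h1 h2 h3 m0 S0.
pose u : int := S - x; pose d : int := x - y.
have hlin : d * (S * (S - m)) + (m + 1) * u * d + m * d ^+ 2
            + 2 * S * u - m * u = 0.
  apply: (mulfI (_ : 4 * m != 0)); first by rewrite mulf_neq0.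
  rewrite mulr0; transitivity (p2 S m x y - p1 S m x y).
    by rewrite /p1 /p2 /u /d; ring.
  by rewrite h1 h2 subrr.
have hq : (m + 1) * u ^+ 2 + 2 * S * u * d + S * (S - m) * d ^+ 2 = 0.
  by rewrite -[RHS]h3 /p3 /u /d; ring.
have hprod : (d ^+ 2 - u) * ((m + 1) * u + m * d) = 0.
  transitivity (d * (d * (S * (S - m)) + (m + 1) * u * d + m * d ^+ 2
            + 2 * S * u - m * u)
     - ((m + 1) * u ^+ 2 + 2 * S * u * d + S * (S - m) * d ^+ 2)); first by ring.
  by rewrite hlin hq mulr0 subrr.
have [d0|d0] := eqVneq d 0.
  left; have hu : u = 0.
    move: hlin hq; rewrite d0 => hlin hq.
    (* If [u] were nonzero, the two relations would give [m = -1] and [2 * S = m], against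
       parity. *)
    have : (m + 1) * u ^+ 2 = 0 by rewrite -hq; ring.
    move/eqP; rewrite mulf_eq0 sqrf_eq0 => /orP[/eqP m1|/eqP //].
    have : (2 * S - m) * u = 0 by rewrite -hlin; ring.
    by move/eqP; rewrite mulf_eq0 => /orP[/eqP ?|/eqP //]; lia.
  have Sx : S = x by apply/eqP; rewrite -subr_eq0 -/u hu.
  have yx : y = x by apply/eqP; rewrite eq_sym -subr_eq0 -/d d0.
  split=> //; have : (S * (S - m)) ^+ 2 = 0.
    by rewrite -[RHS]h1 /p1 -Sx; ring.
  move/eqP; rewrite sqrf_eq0 mulf_eq0 (negPf S0) /= subr_eq0 => /eqP <-.
  exact: Sx.
right; have hu : u = d ^+ 2.
  move/eqP: hprod; rewrite mulf_eq0 => /orP[|/eqP hu].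
    by rewrite subr_eq0 => /eqP.
  by case: (@excluded_factor S m u d m0 d0 hu hq).
split; first by rewrite -subr_eq0.
  by rewrite -[RHS]/(x + d ^+ 2) -hu /u; ring.
(* At [u = d ^+ 2] the relation [hlin] becomes [d * ((S + d) ^+ 2 - m * x) = 0]. *)
apply: (mulfI d0); apply/eqP; rewrite -subr_eq0; apply/eqP.
transitivity (- (d * (S * (S - m)) + (m + 1) * u * d + m * d ^+ 2
            + 2 * S * u - m * u) + (u - d ^+ 2) * (d + 2 * S - m)).
  by rewrite /u /d; ring.
by rewrite hlin hu subrr mul0r addr0 oppr0.
Qed.

(** * Integrality of the parameters on the family [u = d ^+ 2] *)

(** The relation [x * c = e ^+ 2] turns the denominator of [par_Lambda] into [d ^+ 2 * E], and
    [(S - x) * (S - y) = d ^+ 2 * e] cancels the square. *)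
Lemma par_on_family (x d c : rat) (e := d * (d + 1)) (S := x + d ^+ 2)
    (m := x + 2 * e + c) (y := x - d)
    (E := 2 * x ^+ 2 + 3 * e * x + 2 * x + e - e * c) :
  x * c = e ^+ 2 -> d != 0 -> S != 0 -> S - 1 != 0 -> E != 0 ->
  [/\ par_Lambda S m x y = S * (S - 1) * e / E,
      par_T S m x y = S * (m - 1) * e / E,
      par_n S m x y = m * (m - 1) * e / E,
      par_P S m x y = S * e * (c - x - 1) / E &
      par_r S m x y = S * ((d + 2) * e + (d + 1) * c) / E - (d + 1)].
Proof.
move=> xc d0 S0 S1 E0.
have xyd : x - y = d by rewrite /y; ring.
have Sye : S - y = e by rewrite /S /y /e; ring.
have hL : par_Lambda S m x y = S * (S - 1) * e / E.
  rewrite /par_Lambda.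
  have -> : S ^+ 4 - 2 * S ^+ 3 - ((x + y - 1) * (m - 1) - 1) * S ^+ 2
       + x * y * m * (m - 1) = d ^+ 2 * E.
    by move: xc; rewrite /S /m /y /E /e => xc; ring: xc.
  have -> : S - x = d ^+ 2 by rewrite /S; ring.
  by rewrite Sye; field; rewrite E0 d0.
have hT : par_T S m x y = S * (m - 1) * e / E.
  by rewrite /par_T hL; field; rewrite E0 S1.
split=> //.
- by rewrite /par_n hT; field; rewrite E0 S0.
- rewrite /par_P hL xyd.
  have -> : S * (S - 1) - y * (m - 1) = d * (c - x - 1).
    by move: xc; rewrite /S /m /y /e => xc; ring: xc.
  by field; rewrite E0 S1 d0.
- rewrite /par_r hL xyd Sye.
  have -> : m - S = d ^+ 2 + 2 * d + c by rewrite /m /S /e; ring.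
  by rewrite /e; field; rewrite E0 S1 d0.
Qed.

Lemma divq_int_dvdz (a b : int) :
  b != 0 -> a%:Q / b%:Q \is a Num.int -> (b %| a)%Z.
Proof.
move=> b0 /intrP[q hq]; apply/dvdzP; exists q; apply: (@intr_inj rat).
by rewrite intrM -hq divfK // intr_eq0.
Qed.

Lemma family_dvd (x d c : int) (e := d * (d + 1)) (S := x + d ^+ 2)
    (m := x + 2 * e + c) (y := x - d)
    (E := 2 * x ^+ 2 + 3 * e * x + 2 * x + e - e * c) :
  x * c = e ^+ 2 -> d != 0 -> S != 0 -> S - 1 != 0 -> E != 0 ->
  integral_at par_Lambda S m x y -> integral_at par_T S m x y ->
  integral_at par_n S m x y -> integral_at par_P S m x y ->
  integral_at par_r S m x y ->
  (E %| 2 * x * e)%Z /\ (E %| 2 * e ^+ 2)%Z.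
Proof.
move=> xc d0 S0 S1 E0; rewrite /integral_at.
have eQ : e%:~R = d%:Q * (d%:Q + 1) by rewrite /e; ring.
have SQ : S%:~R = x%:Q + d%:Q ^+ 2 by rewrite /S; ring.
have mQ : m%:~R = x%:Q + 2 * e%:Q + c%:Q by rewrite /m; ring.
have yQ : y%:~R = x%:Q - d%:Q by rewrite /y; ring.
have EQ : E%:~R = 2 * x%:Q ^+ 2 + 3 * e%:Q * x%:Q + 2 * x%:Q + e%:Q
                  - e%:Q * c%:Q by rewrite /E; ring.
have xcQ : x%:Q * c%:Q = (d%:Q * (d%:Q + 1)) ^+ 2.
  by rewrite -eQ -intrM xc; ring.
have dQ0 : d%:Q != 0 by rewrite intr_eq0.
have EQ0 : E%:Q != 0 by rewrite intr_eq0.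
have SQ0 : S%:Q != 0 by rewrite intr_eq0.
have SQ1 : S%:Q - 1 != 0.
  by rewrite (_ : S%:Q - 1 = (S - 1)%:~R) ?intr_eq0 //; ring.
have := @par_on_family x%:Q d%:Q c%:Q xcQ dQ0.
rewrite -SQ -eQ -mQ -yQ -EQ => /(_ SQ0 SQ1 EQ0) [-> -> -> -> ->].
move=> hL hT hn hP hr.
have {}hr : S%:Q * ((d%:Q + 2) * e%:Q + (d%:Q + 1) * c%:Q) / E%:Q \is a Num.int.
  move: (rpredD hr (intr_int rat (d + 1))); rewrite [X in _ + X]intrD.
  by rewrite subrK.
move: xcQ; rewrite -eQ => xcQ.
move: hL hT hn => /intrP[? hL] /intrP[? hT] /intrP[? hn].
move: hP hr => /intrP[? hP] /intrP[? hr].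
have xeQ : (2 * x * e)%:~R = 2 * x%:Q * e%:Q by ring.
have eeQ : (2 * e ^+ 2)%:~R = 2 * e%:Q ^+ 2 by ring.
have ecQ : (2 * e + c)%:~R = 2 * e%:Q + c%:Q by ring.
split; apply: divq_int_dvdz => //.
(* The fractions are those of [T], [P], [Lambda], [n] and [r + d + 1]. Modulo [x * c = e ^+ 2] their
   combined numerator is [2 * x * e + (2 * e + c) * E]. *)
- have -> : (2 * x * e)%:Q / E%:Q =
     5%:~R * (S%:Q * (m%:Q - 1) * e%:Q / E%:Q)
     - 3%:~R * (S%:Q * e%:Q * (c%:Q - x%:Q - 1) / E%:Q)
     - 3%:~R * (S%:Q * (S%:Q - 1) * e%:Q / E%:Q)
     - m%:Q * (m%:Q - 1) * e%:Q / E%:Q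
     + 2%:~R * (S%:Q * ((d%:Q + 2) * e%:Q + (d%:Q + 1) * c%:Q) / E%:Q)
     - (2 * e + c)%:~R.
    apply: (mulIf EQ0); rewrite divfK //.
    transitivity (5 * (S%:Q * (m%:Q - 1) * e%:Q)
     - 3 * (S%:Q * e%:Q * (c%:Q - x%:Q - 1))
     - 3 * (S%:Q * (S%:Q - 1) * e%:Q)
     - m%:Q * (m%:Q - 1) * e%:Q
     + 2 * (S%:Q * ((d%:Q + 2) * e%:Q + (d%:Q + 1) * c%:Q))
     - (2 * e + c)%:~R * E%:Q); last by field.
    move: xcQ; rewrite EQ mQ SQ xeQ ecQ eQ => xcQ.
    by ring: xcQ.
  by rewrite hL hT hn hP hr !(rpredB, rpredD, rpredM, intr_int).
(* Here [r + d + 1], [Lambda], [T] and [P] combine to the numerator [2 * e ^+ 2 - e * E]. *)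
- have -> : (2 * e ^+ 2)%:Q / E%:Q =
     S%:Q * ((d%:Q + 2) * e%:Q + (d%:Q + 1) * c%:Q) / E%:Q
     + 3%:~R * (S%:Q * (S%:Q - 1) * e%:Q / E%:Q)
     - 2%:~R * (S%:Q * (m%:Q - 1) * e%:Q / E%:Q)
     + 3%:~R * (S%:Q * e%:Q * (c%:Q - x%:Q - 1) / E%:Q) + e%:~R.
    apply: (mulIf EQ0); rewrite divfK //.
    transitivity (S%:Q * ((d%:Q + 2) * e%:Q + (d%:Q + 1) * c%:Q)
     + 3 * (S%:Q * (S%:Q - 1) * e%:Q)
     - 2 * (S%:Q * (m%:Q - 1) * e%:Q)
     + 3 * (S%:Q * e%:Q * (c%:Q - x%:Q - 1)) + e%:~R * E%:Q); last by field.
    move: xcQ; rewrite EQ mQ SQ eeQ eQ => xcQ.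
    by ring: xcQ.
  by rewrite hL hT hP hr !(rpredB, rpredD, rpredM, intr_int).
Qed.

(** * Size estimates for the common denominator [E] *)

Lemma family_bound (x e c : int)
    (E := 2 * x ^+ 2 + 3 * e * x + 2 * x + e - e * c) :
  x * c = e ^+ 2 -> 0 < x -> 0 < e ->
  (E %| 2 * x * e)%Z -> (E %| 2 * e ^+ 2)%Z -> 2 * x = e.
Proof.
move=> xc x_gt0 e_gt0 hxe hee.
have hE : x * E = (x + e) * (x + e + 1) * (2 * x - e) + e ^+ 2.
  transitivity (2 * x ^+ 3 + 3 * e * x ^+ 2 + 2 * x ^+ 2 + e * x - e * (x * c)).
    by rewrite /E; ring.
  by rewrite xc; ring.
pose G := gcdz x e.
have G_gt0 : 0 < G by rewrite /G /gcdz ltz_nat gcdn_gt0 absz_gt0 gt_eqF.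
(* Bezout merges both divisibilities into one; as the cofactor [q] is nonzero, it bounds [x * E] by
   [2 * x * e * G] in absolute value. *)
have [q hq] : exists q : int, 2 * e * G = q * E.
  apply/dvdzP; have [u [v]] := Bezoutz x e; rewrite -/G => <-.
  rewrite (_ : 2 * e * (u * x + v * e) = u * (2 * x * e) + v * (2 * e ^+ 2)).
    by rewrite rpredD // dvdz_mull.
  by ring.
have [g hg] : exists g : int, 2 * x - e = g * G.
  by apply/dvdzP; rewrite rpredB ?dvdz_mull ?dvdz_gcdl ?dvdz_gcdr.
have hqE : q * (x * E) = 2 * x * e * G by rewrite mulrCA -hq; ring.
have xeG_gt0 : 0 < 2 * x * e * G by rewrite !mulr_gt0.
have q0 : q != 0.
  by apply: contraTneq xeG_gt0 => q0; rewrite -hqE q0 mul0r ltxx.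
have hle : `|x * E| <= 2 * x * e * G.
  rewrite -(gtr0_norm xeG_gt0) -hqE (normrM q) ler_peMl //.
  by rewrite -gtz0_ge1 normr_gt0.
have h_ge0 : 0 <= (x + e) * (x + e + 1) by rewrite mulr_ge0 //; lia.
(* This is the excess of [(x + e) * (x + e + 1) * G - e ^+ 2 * G] over [2 * x * e * G]. It
   contradicts the bound even for [g < 0], where [e ^+ 2 <= e ^+ 2 * G] absorbs the term of opposite
   sign. *)
have hG : 0 < (x ^+ 2 + x + e) * G.
  by rewrite mulr_gt0 // !addr_gt0 // exprn_gt0.
have [g_lt0|g_gt0|g0] := ltgtP g 0; last by move: hg; rewrite g0; lia.
- have gG : 2 * x - e <= - G by rewrite hg -mulN1r ler_pM2r //; lia.
  have := ler_wpM2l h_ge0 gG.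
  have : - (x * E) <= 2 * x * e * G.
    by apply: le_trans hle; rewrite -normrN ler_norm.
  have : 0 <= e ^+ 2 * (G - 1) by rewrite mulr_ge0 ?sqr_ge0 //; lia.
  by rewrite hE; lra.
- have gG : G <= 2 * x - e by rewrite hg; apply: ler_peMl (ltW G_gt0) _; lia.
  have := ler_wpM2l h_ge0 gG.
  have : x * E <= 2 * x * e * G by apply: le_trans hle; rewrite ler_norm.
  have : 0 <= e ^+ 2 * G by rewrite mulr_ge0 ?sqr_ge0 // ltW.
  have := sqr_ge0 e.
  by rewrite hE; lra.
Qed.

(** Since [a / 0 = 0], a vanishing [E] would make the integrality of [par_Lambda] vacuous. But
    [x * E] is positive when [2 * x >= e] and negative when [2 * x - e <= -1]. *)
Lemma family_denom_neq0 (x e c : int) :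
  x * c = e ^+ 2 -> 0 < x -> 0 < e ->
  2 * x ^+ 2 + 3 * e * x + 2 * x + e - e * c != 0.
Proof.
move=> xc x_gt0 e_gt0; apply/eqP => E0.
have hE : (x + e) * (x + e + 1) * (2 * x - e) + e ^+ 2 = 0.
  rewrite -[RHS](mulr0 x) -E0.
  transitivity (2 * x ^+ 3 + 3 * e * x ^+ 2 + 2 * x ^+ 2 + e * x - e * e ^+ 2).
    by ring.
  by rewrite -xc; ring.
have h_ge0 : 0 <= (x + e) * (x + e + 1) by rewrite mulr_ge0 //; lia.
have e2_gt0 : 0 < e ^+ 2 by rewrite exprn_gt0.
have := sqr_ge0 x; have := mulr_gt0 x_gt0 e_gt0.
case: (leP 0 (2 * x - e)) => hg; first by have := mulr_ge0 h_ge0 hg; lra.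
have gN1 : 2 * x - e <= -1 by lia.
by have := ler_wpM2l h_ge0 gN1; lra.
Qed.

Theorem theorem7 (S m x y : int)
  (hp1 : p1 S m x y = 0) (hp2 : p2 S m x y = 0) (hp3 : p3 S m x y = 0)
  (hS : S != 0) (hm : m != 0) (hx : 1 <= x)
  (hLambda : integral_at par_Lambda S m x y)
  (hT : integral_at par_T S m x y)
  (hn : integral_at par_n S m x y)
  (hk : integral_at par_k S m x y)
  (hr : integral_at par_r S m x y)
  (hs : integral_at par_s S m x y)
  (hlambda : integral_at par_lambda S m x y)
  (hN : integral_at par_N S m x y)
  (hP : integral_at par_P S m x y) :
  exists z : int,
    [\/ [/\ S%:Q = 1 / 2 * z%:Q * (3 * z%:Q + 1),
            m%:Q = 9 / 2 * z%:Q * (z%:Q + 1),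
            x%:Q = 1 / 2 * z%:Q * (z%:Q + 1) &
            y%:Q = 1 / 2 * z%:Q * (z%:Q - 1)],
        [/\ S = z, m = z, x = z & y = z] |
        [/\ S = z + 1, m = z, x = z & y = z + 1]].
Proof.
case: (@system_solutions _ _ _ _ hp1 hp2 hp3 hm hS) => [[-> -> ->]|[xy hSd hmx]].
  by exists x; constructor 2.
pose d : int := x - y; pose e : int := d * (d + 1).
pose c : int := m - x - 2 * e.
have yE : y = x - d by rewrite /d; ring.
have d0 : d != 0 by rewrite subr_eq0.
rewrite -/d in hSd hmx.
have mE : m = x + 2 * e + c by rewrite /c; ring.
(* As [S + d = x + e], the relation on [m * x] reads [m * x = (x + e) ^+ 2]. *)
have xc : x * c = e ^+ 2.
  by rewrite /c !mulrBr (mulrC x m) hmx hSd /e; ring.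
(* Since [d] is nonzero, [d = -1] is exactly the case [e = 0]. *)
have [d1|d1] := eqVneq d (-1).
  exists x; constructor 3; split=> //.
  - by rewrite hSd d1; ring.
  - by apply: (mulIf (_ : x != 0)); [lia|rewrite hmx hSd d1; ring].
  - by rewrite yE d1; ring.
have e_gt0 : 0 < e := @mulzS_gt0 d d0 d1.
have x_gt0 : 0 < x by lia.
have d2_gt0 : 0 < d ^+ 2 by rewrite lt_def sqr_ge0 sqrf_eq0 d0.
have E0 := @family_denom_neq0 _ _ _ xc x_gt0 e_gt0.
have S1 : S - 1 != 0 by rewrite hSd; lia.
have x2 : 2 * x = e.
  move: hS S1 hLambda hT hn hP hr; rewrite hSd mE yE => S0 S1 hL hT' hn' hP' hr'.
  have [hxe hee] := @family_dvd x d c xc d0 S0 S1 E0 hL hT' hn' hP' hr'.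
  exact: family_bound xc x_gt0 e_gt0 hxe hee.
exists d; constructor 1.
have hx2 : 2 * x%:Q = d%:Q * (d%:Q + 1).
  have <- : e%:~R = d%:Q * (d%:Q + 1) by rewrite /e; ring.
  by rewrite -x2; ring.
(* With [e = 2 * x], the square [(x + e) ^+ 2] is [9 * x ^+ 2]. *)
have m9 : m = 9 * x.
  apply: (mulIf (_ : x != 0)); first by lia.
  transitivity ((x + e) ^+ 2); first by rewrite hmx hSd /e; ring.
  by rewrite -x2; ring.
have xQ : x%:Q = 1 / 2 * d%:Q * (d%:Q + 1) by lra.
have SQ : S%:Q = x%:Q + d%:Q ^+ 2 by rewrite hSd; ring.
have mQ : m%:Q = 9 * x%:Q by rewrite m9; ring.
have yQ : y%:Q = x%:Q - d%:Q by rewrite yE; ring.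
by split; rewrite ?SQ ?mQ ?yQ xQ; field.
Qed.
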